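(* Let $\kappa$ be an infinite regular cardinal, let $X$ be a set with $|X|=\kappa$, and let $\tau$ be a nonempty family of subsets of $X$. Then the following conditions are equivalent. (1) $(X,\tau)$ is $[\kappa\cdot\kappa,\kappa\cdot\kappa]$-compact. (2) $(X,\tau)$ is $[\alpha,\alpha]$-compact for some limit ordinal $\alpha$ of the form $\alpha=\kappa\cdot\alpha_1$, for some ordinal $\alpha_1>0$ with $|\alpha_1|\le\kappa$. (3) $(X,\tau)$ is $[\alpha,\alpha]$-compact for every ordinal $\alpha$ of the form $\alpha_1+\kappa^{\varepsilon}$, for some ordinals $\alpha_1\ge 0$ and $\varepsilon>1$ such that $\varepsilon$ is either a successor ordinal or $\operatorname{cf}\varepsilon=\kappa$. (4) $(X,\tau)$ is $[\alpha,\alpha+\kappa\cdot\omega)$-compact for every ordinal $\alpha$ of the form $\alpha_1+\kappa^{\varepsilon}$, for some ordinals $\alpha_1\ge 0$ and $\varepsilon>1$ such that $\varepsilon$ is either a successor ordinal or $\operatorname{cf}\varepsilon=\kappa$. If, in addition, $\tau$ is closed under arbitrary unions, then the preceding conditions are also equivalent to: (5) $(X,\tau)$ is $[\alpha,\alpha]$-compact for some nonzero ordinal $\alpha$ such that $|\alpha|\le\kappa$.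
   Context: For a nonempty set $X$, a nonempty family $\tau$ of subsets of $X$ (not necessarily a topology) and nonzero ordinals $\alpha,\beta$, $(X,\tau)$ is $[\beta,\alpha]$-compact if, whenever $(O_\delta)_{\delta\in\alpha}$ is a sequence of members of $\tau$ (repetitions allowed) with $\bigcup_{\delta\in\alpha}O_\delta=X$, there is $H\subseteq\alpha$ of order type $<\beta$ (in the induced order) with $\bigcup_{\delta\in H}O_\delta=X$. $(X,\tau)$ is $[\beta,\alpha)$-compact if it is $[\beta,\alpha']$-compact for every nonzero $\alpha'<\alpha$. The operations $+$, $\cdot$ and exponentiation are ordinal operations; cardinals are identified with initial ordinals; the Axiom of Choice is assumed. *)

(* Defs.v *)
From mathcomp Require Import all_boot.
From mathcomp Require Import boolp classical_sets functions cardinality.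
Set Implicit Arguments.
Unset Strict Implicit.
Unset Printing Implicit Defensive.

Local Open Scope classical_set_scope.
Local Open Scope card_scope.

(* Ordinals are represented by well-ordered types; equality of ordinals is     *)
(* order isomorphism ([order_iso]), never equality of the representing types.  *)
Record ord := Ord {
  ord_sort :> Type;
  ord_rel : ord_sort -> ord_sort -> Prop;
  ord_rel_trans : forall y x z, ord_rel x y -> ord_rel y z -> ord_rel x z;
  ord_rel_total : forall x y, [\/ ord_rel x y, x = y | ord_rel y x];
  ord_rel_wf : well_founded ord_rel }.

Declare Scope ord_scope.
Delimit Scope ord_scope with ord.
Bind Scope ord_scope with ord.

Fact ord_rel_irr (C : ord) (x : C) : ~ ord_rel x x.
Proof.
by elim/(well_founded_ind (@ord_rel_wf C)): x => x IH xx; apply: (IH x xx xx).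
Qed.

Section Suborder.
Variables (A : ord) (H : set A).

Definition sub_rel (x y : H) := ord_rel (val x) (val y).

Fact sub_rel_trans y x z : sub_rel x y -> sub_rel y z -> sub_rel x z.
Proof. exact: ord_rel_trans. Qed.

Fact sub_rel_total x y : [\/ sub_rel x y, x = y | sub_rel y x].
Proof.
by case: (ord_rel_total (val x) (val y)) => h;
  [apply: Or31 | apply/Or32/val_inj | apply: Or33].
Qed.

Fact sub_rel_wf : well_founded sub_rel.
Proof.
move=> x; have [a ax] : exists a, a = val x by exists (val x).
elim/(well_founded_ind (@ord_rel_wf A)): a x ax => a IH x ax.
by constructor=> y; rewrite /sub_rel -ax => /IH; apply.
Qed.

Definition suborder := Ord sub_rel_trans sub_rel_total sub_rel_wf.
End Suborder.

Definition initial_seg (A : ord) (a : A) : set A := [set x | ord_rel x a].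

Definition order_iso (A B : ord) :=
  exists2 f : A -> B, bijective f & forall x y, ord_rel x y <-> ord_rel (f x) (f y).

Definition ord_lt (A B : ord) :=
  exists b : B, order_iso A (suborder (initial_seg b)).

Definition ord_le (A B : ord) := ord_lt A B \/ order_iso A B.

Definition ord_nonzero (A : ord) := [set: A] !=set0.

Fact unit_rel_total (x y : unit) : [\/ False, x = y | False].
Proof. by case: x y => -[]; apply: Or32. Qed.

Fact unit_rel_wf : well_founded (fun _ _ : unit => False).
Proof. by move=> x; constructor. Qed.

Definition ord_one :=
  @Ord unit (fun _ _ => False) (fun _ _ _ h _ => h) unit_rel_total unit_rel_wf.

Fact nat_rel_trans (n m p : nat) : m < n -> n < p -> m < p.
Proof. exact: ltn_trans. Qed.

Fact nat_rel_total (m n : nat) : [\/ m < n, m = n | n < m].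
Proof. by case: (ltngtP m n) => h; [apply: Or31|apply: Or33|apply: Or32]. Qed.

Fact nat_rel_wf : well_founded (fun m n : nat => m < n).
Proof.
move=> n; suff: forall m, m <= n -> Acc (fun m n : nat => m < n) m by apply.
elim: n => [|n IH] m mn; constructor=> k km.
  by move: (leq_trans km mn).
by apply: IH; rewrite -ltnS; apply: leq_trans mn.
Qed.

Definition ord_omega :=
  @Ord nat (fun m n => m < n) nat_rel_trans nat_rel_total nat_rel_wf.

Section Sum.
Variables A B : ord.

Definition add_rel (u v : A + B) :=
  match u, v with
  | inl a, inl a' => ord_rel a a'
  | inl _, inr _ => True
  | inr _, inl _ => False
  | inr b, inr b' => ord_rel b b'
  end.

Fact add_rel_trans v u w : add_rel u v -> add_rel v w -> add_rel u w.
Proof. by case: u v w => [a|b] [a'|b'] [a''|b''] //=; apply: ord_rel_trans. Qed.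

Fact add_rel_total u v : [\/ add_rel u v, u = v | add_rel v u].
Proof.
case: u v => [a|b] [a'|b'] /=; try by [apply: Or31 | apply: Or33].
  by case: (ord_rel_total a a') => h; [apply: Or31|apply: Or32; rewrite h|apply: Or33].
by case: (ord_rel_total b b') => h; [apply: Or31|apply: Or32; rewrite h|apply: Or33].
Qed.

Fact add_rel_wf : well_founded add_rel.
Proof.
have accl a : Acc add_rel (inl a).
  elim/(well_founded_ind (@ord_rel_wf A)): a => a IH.
  by constructor=> -[a' /IH|].
case=> [//|b]; elim/(well_founded_ind (@ord_rel_wf B)): b => b IH.
by constructor=> -[a _|b' /IH].
Qed.

Definition ord_add := Ord add_rel_trans add_rel_total add_rel_wf.
End Sum.

Section Product.
Variables A B : ord.

(* B copies of A one after the other: the second component dominates. *)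
Definition mul_rel (u v : A * B) :=
  ord_rel u.2 v.2 \/ u.2 = v.2 /\ ord_rel u.1 v.1.

Fact mul_rel_trans v u w : mul_rel u v -> mul_rel v w -> mul_rel u w.
Proof.
case: u v w => [a b] [a' b'] [a'' b''] [/= h|[/= -> h]] [/= k|[/= <- k]].
- by left; apply: ord_rel_trans k.
- by left.
- by left.
- by right; split=> //; apply: ord_rel_trans k.
Qed.

Fact mul_rel_total u v : [\/ mul_rel u v, u = v | mul_rel v u].
Proof.
case: u v => [a b] [a' b'].
case: (ord_rel_total b b') => [h|->|h]; [by apply: Or31; left| |by apply: Or33; left].
by case: (ord_rel_total a a') => [h|->|h];
  [apply: Or31; right | apply: Or32 | apply: Or33; right].
Qed.

Fact mul_rel_wf : well_founded mul_rel.
Proof.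
case=> a b; elim/(well_founded_ind (@ord_rel_wf B)): b a => b IHb a.
elim/(well_founded_ind (@ord_rel_wf A)): a => a IHa.
by constructor=> -[a' b'] [/= /IHb //|[/= -> /IHa]].
Qed.

Definition ord_mul := Ord mul_rel_trans mul_rel_total mul_rel_wf.
End Product.

Section Power.
Variables A B : ord.

(* A ^ B is the set of functions from B to A that take a non-least value only  *)
(* finitely often, compared at the largest argument where they differ.         *)
Definition pow_supp (f : B -> A) : set B := [set b | exists a, ord_rel a (f b)].

Definition pow_sort := {f : B -> A | finite_set (pow_supp f)}.

Definition pow_rel (f g : pow_sort) :=
  exists b, ord_rel (sval f b) (sval g b) /\
            forall b', ord_rel b b' -> sval f b' = sval g b'.

Fact pow_rel_trans g f h : pow_rel f g -> pow_rel g h -> pow_rel f h.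
Proof.
move=> [b [fgb fg]] [c [ghc gh]].
case: (ord_rel_total b c) => [bc|bc|cb].
- exists c; split; first by rewrite fg.
  by move=> d cd; rewrite fg ?gh //; apply: ord_rel_trans cd.
- subst c; exists b; split; first exact: ord_rel_trans ghc.
  by move=> d bd; rewrite fg ?gh.
- exists b; split; first by rewrite -gh.
  by move=> d bd; rewrite fg ?gh //; apply: ord_rel_trans bd.
Qed.

Fact finite_ord_max (C : ord) (S : set C) : finite_set S -> S !=set0 ->
  exists2 m, S m & forall x, S x -> x = m \/ ord_rel x m.
Proof.
move=> /(@finite_seqP {classic C})[s ->]; elim: s => [[x //]|x s IH _].
have [[y ys]|none] := pselect ([set` s] !=set0); last first.
  exists x => [|y]; rewrite /= inE ?eqxx// => /predU1P[->|ys]; first by left.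
  by case: none; exists y.
have [|m ms mmax] := IH; first by exists y.
case: (ord_rel_total x m) => [xm|xm|mx].
- exists m => [|z]; rewrite /= inE; first by apply/orP; right.
  by move=> /predU1P[->|/mmax//]; right.
- exists m => [|z]; rewrite /= inE; first by apply/orP; right.
  by move=> /predU1P[->|/mmax//]; left.
- exists x => [|z]; rewrite /= inE ?eqxx// => /predU1P[->|/mmax]; first by left.
  by case=> [->|zm]; right=> //; apply: ord_rel_trans mx.
Qed.

Fact pow_rel_total f g : [\/ pow_rel f g, f = g | pow_rel g f].
Proof.
have [[b fgb]|] := pselect ([set b | sval f b <> sval g b] !=set0); last first.
  move=> fg; apply: Or32; case: f g fg => [f ff] [g fg] /= fgE.
  apply: eq_exist; apply: funext => b; apply: contrapT => ?.
  by apply: fgE; exists b.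
have [||m mS mmax] := @finite_ord_max B [set b | sval f b <> sval g b].
- apply: (@sub_finite_set _ _ (pow_supp (sval f) `|` pow_supp (sval g))); last first.
    by rewrite finite_setU; split; [exact: (proj2_sig f) | exact: (proj2_sig g)].
  move=> c /= fgc; case: (ord_rel_total (sval f c) (sval g c)) => // h.
    by right; exists (sval f c).
  by left; exists (sval g c).
- by exists b.
have eqm b' : ord_rel m b' -> sval f b' = sval g b'.
  move=> mb'; apply: contrapT => /mmax[|] h; first by subst; case: (ord_rel_irr mb').
  exact: (ord_rel_irr (ord_rel_trans mb' h)).
case: (ord_rel_total (sval f m) (sval g m)) => // h.
  by apply: Or31; exists m.
by apply: Or33; exists m; split=> // b' /eqm.
Qed.

(* [pow_rel] restricted to pairs whose largest difference lies in D. *)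
Let below (D : set B) (f g : pow_sort) :=
  exists b, [/\ D b, ord_rel (sval f b) (sval g b) &
            forall b', ord_rel b b' -> sval f b' = sval g b'].

Let below_wf_step (D : set B) :
  (forall m, D m -> well_founded (below (initial_seg m))) ->
  well_founded (below D).
Proof.
move=> wfD f.
have [[b0 Sb0]|none] := pselect (pow_supp (sval f) `&` D !=set0); last first.
  constructor=> g [b [Db gfb _]]; case: none.
  by exists b; split=> //; exists (sval g b).
have [||m [_ Dm] mmax] := @finite_ord_max B (pow_supp (sval f) `&` D).
- by apply: sub_finite_set (proj2_sig f) => x [].
- by exists b0.
have {b0 Sb0 mmax} : forall x, D x -> pow_supp (sval f) x -> x = m \/ ord_rel x m.
  by move=> x Dx fx; apply: mmax.
have [a ax] : exists a, a = sval f m by exists (sval f m).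
elim/(well_founded_ind (@ord_rel_wf A)): a f ax => a IHa f.
elim/(well_founded_ind (wfD m Dm)): f => f IHf afm fmax.
constructor=> g [b [Db gfb gfE]].
have gmax x : D x -> pow_supp (sval g) x -> x = m \/ ord_rel x m.
  move=> Dx; case: (ord_rel_total b x) => [bx|<- _|xb _].
  - by rewrite /pow_supp /= gfE //; apply: fmax.
  - by apply: fmax => //; exists (sval g b).
  - have [|<-|bm] := fmax b Db; first by exists (sval g b).
      by right.
    by right; apply: ord_rel_trans bm.
have [|bm|bm] := fmax b Db; first by exists (sval g b).
  by subst b; apply: (IHa (sval g m)) => //; rewrite afm.
apply: IHf => //; first by exists b.
by rewrite gfE.
Qed.

Fact pow_rel_wf : well_founded pow_rel.
Proof.
have seg_wf m : well_founded (below (initial_seg m)).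
  by elim/(well_founded_ind (@ord_rel_wf B)): m => m; apply: below_wf_step.
have T_wf : well_founded (below setT) by apply: below_wf_step.
move=> f; elim/(well_founded_ind T_wf): f => f IH.
by constructor=> g [b [gfb gfE]]; apply: IH; exists b.
Qed.

Definition ord_pow := Ord pow_rel_trans pow_rel_total pow_rel_wf.
End Power.

Notation "1" := ord_one : ord_scope.
Notation "A < B" := (ord_lt A B) : ord_scope.
Notation "A <= B" := (ord_le A B) : ord_scope.
Notation "A + B" := (ord_add A B) : ord_scope.
Notation "A * B" := (ord_mul A B) : ord_scope.
Notation "A ^ B" := (ord_pow A B) : ord_scope.

Definition is_successor (A : ord) := exists B : ord, order_iso A (B + 1)%ord.

Definition is_limit (A : ord) := ord_nonzero A /\ ~ is_successor A.

Definition cofinal (A : ord) (C : set A) :=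
  forall a : A, exists2 c, C c & a = c \/ ord_rel a c.

(* The cofinality of A is the least order type of a cofinal subset of A. *)
Definition has_cofinality (A B : ord) :=
  (exists2 C : set A, cofinal C & order_iso B (suborder C)) /\
  (forall C : set A, cofinal C -> (B <= suborder C)%ord).

Definition is_cardinal (A : ord) :=
  forall B : ord, (B < A)%ord -> ~ ([set: B] #= [set: A]).

Definition infinite_regular_cardinal (K : ord) :=
  [/\ is_cardinal K, infinite_set [set: K] & has_cofinality K K].

Section Compactness.
Variables (X : Type) (tau : set (set X)).

(* [[B, A]]-compactness; B and A are meant to be nonzero. *)
Definition ord_compact (B A : ord) :=
  forall O : A -> set X, (forall d, tau (O d)) -> \bigcup_d O d = setT ->
  exists2 H : set A, (suborder H < B)%ord & \bigcup_(d in H) O d = setT.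

Definition ord_compact_below (B A : ord) :=
  forall A' : ord, ord_nonzero A' -> (A' < A)%ord -> ord_compact B A'.

Definition union_closed :=
  forall F : set (set X), F `<=` tau -> tau (\bigcup_(U in F) U).
End Compactness.

(* A = A1 + K ^ E with E > 1 and E a successor or cf E = K *)
Definition special_form (K A : ord) :=
  exists A1 E : ord, [/\ order_iso A (A1 + K ^ E)%ord, (1 < E)%ord &
    is_successor E \/ has_cofinality E K].

(* Main.v *)
Require Import Defs.
From Stdlib Require Import Wellfounded.
From mathcomp Require Import all_boot.
From mathcomp Require Import boolp classical_sets functions cardinality.
Local Open Scope classical_set_scope.
Local Open Scope card_scope.
Set Implicit Arguments.
Unset Strict Implicit.

(** Everything follows from one construction.  Call [A] special when it has the
form [A1 + K ^ E] of conditions (3) and (4).  Suppose that some cover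
[O] indexed by an ordinal [A' < A + K * omega] has no subcover of order type
less than [A].  Then [X] carries a grid [N : K -> J -> set X] of members of
[tau] with as many columns as we like, up to [|K|]: the grid covers [X], and
each column [c] contains witnesses, points that lie in no other column and
that avoid any prescribed bounded part of column [c] ([noncompact_grid]).
A subfamily of the grid that covers [X] must therefore be unbounded, so of
order type [K], in every column.

A grid with [A1] columns, read column after column, is a sequence of type
[K * A1] none of whose subcovers is shorter ([grid_not_compact_mul]).  So (2)
excludes covers such as [O], which is (4).  When [tau] is closed under unions, the
union of each column is a member of [tau] and no column can be omitted
([grid_not_compact_union]), so (5) excludes them too.  The other implications
are specializations: [K * K] is of the form [0 + K ^ 2], and it has cardinality
[|K|], which is proved here by ordering pairs in the manner of Goedel
([card_ord_sq]).

To build a grid, write the indices of the given cover as elements of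
[A + K * omega], and say that a point is bounded if the indices of the sets
containing it are bounded in [A].  Two properties of special ordinals are used:
fewer than [K] elements are always bounded ([short_bounded]), and above every
element there is a bounded copy of [K] ([roomy]).
- The unbounded points can be covered by choosing for each of them, along
  an enumeration of [X] in type [K], an index beyond those already chosen;
  the chosen indices that lie in [A] have order type at most [K].
- An initial segment of [A], these indices, and the indices outside [A], which
  have a type less than [K * omega], have together a type less than [A],
  because [A] is roomy.
  Hence they do not cover [X]: there is a bounded point all of whose indices lie
  beyond any given element of [A] ([far_point]).
- By recursion, such points can be chosen with pairwise disjoint sets of indices
  ([independent_points]): at each stage fewer than [K] bounded sets of indices
  have to be avoided, and their union is bounded.
Giving each column [K] many of these points as witnesses, and the sets that
contain them, yields the grid ([independent_grid]). *)

(** * Recursion, well-orders and order types *)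

(** Transfinite recursion by arbitrary choices.  The choice at [t] has to be
possible for every assignment [f] of earlier values, even one that does not
itself result from the recursion; this spares a joint induction with the
properties of the earlier values. *)
Lemma wf_choice (T V : Type) (R : T -> T -> Prop)
    (P : forall t, (forall s, R s t -> V) -> V -> Prop) :
  well_founded R -> (forall t f, exists v, P t f v) ->
  exists u : T -> V, forall t, P t (fun s _ => u s) (u t).
Proof.
move=> Rwf exP.
pose F t f := sval (cid (exP t f)).
exists (Fix Rwf (fun=> V) F) => t; rewrite Fix_eq; first exact: (svalP (cid (exP t _))).
move=> x f g fg; congr F.
by apply: functional_extensionality_dep => y; apply: functional_extensionality_dep.
Qed.

Lemma ord_min (A : ord) (P : set A) : P !=set0 ->
  exists2 m, P m & forall x, P x -> ~ ord_rel x m.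
Proof.
case=> x; elim/(well_founded_ind (@ord_rel_wf A)): x => x IH Px.
have [[y [Py yx]]|no] := pselect (exists y, P y /\ ord_rel y x); first exact: IH yx Py.
by exists x => // y Py yx; apply: no; exists y.
Qed.

Definition increasing (A B : ord) (f : A -> B) :=
  forall x y, ord_rel x y -> ord_rel (f x) (f y).

Lemma increasing_reflect (A B : ord) (f : A -> B) x y :
  increasing f -> ord_rel (f x) (f y) -> ord_rel x y.
Proof.
move=> fi fxy; case: (ord_rel_total x y) => // [xy|/fi yx].
  by subst y; case: (ord_rel_irr fxy).
by case: (ord_rel_irr (ord_rel_trans fxy yx)).
Qed.

Lemma increasing_inj (A B : ord) (f : A -> B) : increasing f -> injective f.
Proof.
move=> fi x y fxy; case: (ord_rel_total x y) => // /fi; rewrite fxy => /ord_rel_irr //.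
Qed.

Lemma increasing_surj_iso (A B : ord) (f : A -> B) :
  increasing f -> (forall y, exists x, f x = y) -> order_iso A B.
Proof.
move=> fi /choice[g fK]; exists f => [|x y]; last first.
  by split; [exact: fi | exact: increasing_reflect].
by exists g => // x; apply: (increasing_inj fi).
Qed.

Lemma order_iso_refl (A : ord) : order_iso A A.
Proof. by exists id => //; exists id. Qed.

(** A least [x] sent below itself would make [f x] a smaller one. *)
Lemma increasing_expansive (A : ord) (f : A -> A) x :
  increasing f -> ~ ord_rel (f x) x.
Proof.
move=> fi; elim/(well_founded_ind (@ord_rel_wf A)): x => x IH fx.
exact: IH fx (fi _ _ fx).
Qed.

(** How lower bounds on the order type of a subset are obtained: a copy of [A]
inside [H], followed by an isomorphism of [H] with a proper initial segment
of [A], would send an element of [A] below itself. *)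
Lemma suborder_not_lt (A B : ord) (H : set B) (e : A -> B) :
  increasing e -> (forall x, H (e x)) -> ~ (suborder H < A)%ord.
Proof.
move=> ei He [b [h _ hi]].
pose F (x : A) : A := val (h (exist _ (e x) (mem_set (He x)))).
apply: (@increasing_expansive A F b) => [x y xy|].
  by apply/(hi (exist _ _ _) (exist _ _ _)); apply: ei.
exact: (set_valP (h _)).
Qed.

(** How upper bounds on order types are obtained.  The image of [g] need not be
an initial segment; the Mostowski collapse [u], which takes at each step the least value
not yet used, stays below [g] and has an initial segment as its image. *)
Lemma bounded_ord_lt (A B : ord) (g : B -> A) (b : A) :
  increasing g -> (forall x, ord_rel (g x) b) -> (B < A)%ord.
Proof.
move=> gi gb.
have [|u uP] := @wf_choice B A (@ord_rel B) (fun x f v =>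
    (exists w, forall y (yx : ord_rel y x), f y yx <> w) ->
    (forall y (yx : ord_rel y x), f y yx <> v) /\
    (forall w, ord_rel w v -> exists y (yx : ord_rel y x), f y yx = w))
    (@ord_rel_wf B).
  move=> x f.
  have [[w wP]|no] := pselect (exists w, forall y (yx : ord_rel y x), f y yx <> w).
    have [|m mP mmin] := @ord_min A [set w | forall y (yx : ord_rel y x), f y yx <> w].
      by exists w.
    exists m => _; split=> // z zm; apply: contrapT => noy; apply: (mmin z) zm.
    by move=> y yx fz; apply: noy; exists y, yx.
  by exists b => /no.
(* As long as [u] stays below [g], the value [g x] is unused at stage [x]; so the
   recursion never runs out of values, and the next one is at most [g x]. *)
have ug x : ~ ord_rel (g x) (u x).
  elim/(well_founded_ind (@ord_rel_wf B)): x => x IH gu.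
  have fresh y : ord_rel y x -> u y <> g x.
    by move=> yx ugx; apply: (IH y yx); rewrite ugx; apply: gi.
  have [|_ /(_ _ gu)[y [yx]]] := uP x; first by exists (g x).
  exact: fresh.
have {}uP x : (forall y, ord_rel y x -> u y <> u x) /\
    (forall w, ord_rel w (u x) -> exists2 y, ord_rel y x & u y = w).
  have [|u1 u2] := uP x; last by split=> // w /u2[y [yx <-]]; exists y.
  by exists (g x) => y yx ugx; apply: (ug y); rewrite ugx; apply: gi.
have ui : increasing u.
  move=> y x yx; case: (ord_rel_total (u y) (u x)) => // [E|].
    by have := (uP x).1 y yx E.
  move=> /(uP y).2[z zy uz]; have := (uP x).1 z (ord_rel_trans zy yx); by case.
have [|a aP amin] := @ord_min A [set w | forall x, u x <> w].
  by exists b => x ux; apply: (@ug x); rewrite ux.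
have ua x : ord_rel (u x) a.
  case: (ord_rel_total (u x) a) => // [/aP//|/(uP x).2[y _ /aP//]].
exists a; pose f (x : B) : suborder (initial_seg a) := exist _ (u x) (mem_set (ua x)).
apply: (@increasing_surj_iso _ _ f) => [x y /ui //|[w wa]].
have : ord_rel w a by move: wa => /[dup] /set_mem.
move=> wa'; have [x uw] : exists x, u x = w.
  apply: contrapT => no; apply: (amin w) => // x uw; apply: no; by exists x.
by exists x; apply: val_inj.
Qed.

Lemma bounded_suborder_lt (A B : ord) (H : set B) (f : B -> A) (b : A) :
  (forall x y, H x -> H y -> ord_rel x y -> ord_rel (f x) (f y)) ->
  (forall x, H x -> ord_rel (f x) b) -> (suborder H < A)%ord.
Proof.
move=> fi fb; apply: (@bounded_ord_lt A (suborder H) (fun x => f (val x)) b).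
  by move=> x y xy; apply: fi => //; apply: set_valP.
by move=> x; apply: fb; apply: set_valP.
Qed.

Lemma ord_max2 (A : ord) (a b : A) : exists c, (forall x, ord_rel x a -> ord_rel x c) /\
  (forall x, ord_rel x b -> ord_rel x c).
Proof.
case: (ord_rel_total a b) => [ab|->|ba]; first last.
- by exists a; split=> // x xb; apply: ord_rel_trans ba.
- by exists b.
- by exists b; split=> // x xa; apply: ord_rel_trans ab.
Qed.

Lemma lt_add (A B : ord) (b : B) : (A < A + B)%ord.
Proof.
have [|m _ mmin] := @ord_min B setT; first by exists b.
exists (inr m).
have inA a : (initial_seg (inr m : (A + B)%ord)) (inl a) by [].
pose f (a : A) : suborder (initial_seg (inr m : (A + B)%ord)) :=
  exist _ (inl a) (mem_set (inA a)).
apply: (@increasing_surj_iso _ _ f) => [x y //|y].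
have := set_valP y; case E: (val y) => [a|b'] /=; last by move/mmin; case.
by move=> _; exists a; apply: val_inj.
Qed.

(** * The square of an infinite cardinal *)

Lemma card_le_fun (T U : Type) (A : set T) (B : set U) (f : T -> U) :
  (forall x, A x -> B (f x)) ->
  (forall x y, A x -> A y -> f x = f y -> x = y) -> A #<= B.
Proof.
move=> fAB finj.
have fI : {in A &, injective f} by move=> x y /set_mem Ax /set_mem Ay; apply: finj.
have /card_eqPle[_ Af] := inj_card_eq fI.
by apply: card_le_trans Af _; apply: subset_card_le => _ [x Ax <-]; apply: fAB.
Qed.

Lemma card_le_ex (T U : Type) (A : set T) (B : set U) (u0 : U) : A #<= B ->
  exists f : T -> U, (forall x, A x -> B (f x)) /\
  (forall x y, A x -> A y -> f x = f y -> x = y).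
Proof.
move=> /card_leP[f].
have /choice[g gP] : forall x, exists u, forall Ax : x \in A, u = val (f (exist _ x Ax)).
  move=> x; have [Ax|nA] := pselect (x \in A); last by exists u0 => Ax; case: (nA Ax).
  by exists (val (f (exist _ x Ax))) => Ax'; rewrite (Prop_irrelevance Ax Ax').
exists g; split=> [x Ax|x y Ax Ay].
  by rewrite (gP x (mem_set Ax)); apply: (set_valP (f _)).
rewrite (gP x (mem_set Ax)) (gP y (mem_set Ay)) => /val_inj E.
have := @inj _ _ _ f _ _ _ _ E; rewrite !inE => /(_ I I) /(congr1 val) //.
Qed.

(** Hilbert's hotel: along a copy of [nat] in [A], shift by one to make room
for [a]. *)
Lemma infinite_adjoin (T : Type) (A : set T) (a : T) :
  infinite_set A -> A `|` [set a] #<= A.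
Proof.
move=> /infiniteP /(card_le_ex a)[i [iA iI]].
have {}iI m n : i m = i n -> m = n by apply: iI.
pose f x := if pselect (x = a) then i 0 else
  if pselect (exists n, i n = x) is left h then i (sval (cid h)).+1 else x.
have fa : f a = i 0 by rewrite /f; case: pselect.
have fi n : i n <> a -> f (i n) = i n.+1.
  rewrite /f => ina; case: pselect => //= ?; case: pselect => [h|no].
    by congr (i _.+1); apply: iI; apply: (svalP (cid h)).
  by case: no; exists n.
have fo x : x <> a -> (forall n, i n <> x) -> f x = x.
  move=> xa xi; rewrite /f; case: pselect => //= ?.
  by case: pselect => [[n ?]|//]; case: (xi n).
have cases x : [\/ x = a /\ f x = i 0,
    exists2 n, x = i n & x <> a /\ f x = i n.+1 |
    (forall n, i n <> x) /\ (x <> a /\ f x = x)].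
  have [->|xa] := pselect (x = a); first by apply: Or31.
  have [[n xn]|no] := pselect (exists n, i n = x).
    by apply: Or32; exists n => //; split=> //; rewrite -xn; apply: fi; rewrite xn.
  have xi n : i n <> x by move=> xn; apply: no; exists n.
  by apply: Or33; split=> //; split=> //; apply: fo.
apply: (@card_le_fun _ _ _ _ f) => [x Ax|x y _ _].
  case: (cases x) => [[_ ->]|[n _ [_ ->]]|[_ [xa ->]]]; [exact: iA|exact: iA|].
  by case: Ax.
case: (cases x) => [[-> ->]|[n -> [xa ->]]|[xi [xa ->]]];
  case: (cases y) => [[-> ->]|[m -> [ya ->]]|[yi [ya ->]]] //.
- by move=> /iI.
- by move=> /yi.
- by move=> /iI.
- by move=> /iI[->].
- by move=> /yi.
- by move/esym => /xi.
- by move/esym => /xi.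
Qed.

Lemma card_le_setX (T T' U U' : Type) (A : set T) (B : set U) (A' : set T') (B' : set U')
    (u0 : U) (u0' : U') :
  A #<= B -> A' #<= B' -> A `*` A' #<= B `*` B'.
Proof.
move=> /(card_le_ex u0)[f [fB fI]] /(card_le_ex u0')[g [gB gI]].
apply: (@card_le_fun _ _ _ _ (fun p => (f p.1, g p.2))).
  by move=> [x y] [/= Ax Ay]; split; [apply: fB|apply: gB].
move=> [x y] [x' y'] [/= Ax Ay] [/= Ax' Ay'] [/fI -> // /gI -> //].
Qed.

Section Square.
Variable C : ord.

Definition pair_max (p : C * C) : C := if pselect (ord_rel p.1 p.2) then p.2 else p.1.

Definition upto (m : C) : set C := initial_seg m `|` [set m].

Lemma le_pair_max p : upto (pair_max p) p.1 /\ upto (pair_max p) p.2.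
Proof.
rewrite /pair_max; case: pselect => [lt|nlt] /=; first by split; [left|right].
split; first by right.
by case: (ord_rel_total p.1 p.2) => // h; [right|left].
Qed.

Lemma pair_max_lt p a : ord_rel p.1 a -> ord_rel p.2 a -> ord_rel (pair_max p) a.
Proof. by rewrite /pair_max; case: pselect. Qed.

(** Comparing these triples in [ord_mul] orders pairs by their maximum first;
keeping the pair itself makes the comparison total. *)
Definition godel (p : C * C) : ((C * C) * C)%ord := (p, pair_max p).

Lemma godel_pred p p' : ord_rel (godel p') (godel p) ->
  upto (pair_max p) p'.1 /\ upto (pair_max p) p'.2.
Proof.
have [h1 h2] := le_pair_max p'.
have up x m m' : upto m' x -> ord_rel m' m \/ m' = m -> upto m x.
  move=> ux [m'm|<- //]; left; case: ux => [xm'|/= ->//].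
  exact: ord_rel_trans m'm.
by move=> pp'; split; apply: up; [exact: h1| |exact: h2|];
   case: pp' => [/= ?|[/= ? _]]; [left|right|left|right].
Qed.

(** Hessenberg's theorem, by induction on [a].  If [initial_seg a] is
equipotent to a smaller segment, the induction hypothesis transfers.  Otherwise
the Goedel predecessors of a pair below [a] lie in a square [upto m] x [upto m]
with [m < a], which is too small to exhaust [initial_seg a]; so one can
choose recursively distinct elements of [initial_seg a] for all pairs. *)
Lemma card_initial_seg_sq (a : C) : infinite_set (initial_seg a) ->
  initial_seg a `*` initial_seg a #<= initial_seg a.
Proof.
elim/(well_founded_ind (@ord_rel_wf C)): a => a IH ainf.
have [[m [ma am]]|noeq] := pselect (exists m, ord_rel m a /\
    initial_seg a #<= initial_seg m).
  have minf : infinite_set (initial_seg m).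
    by move=> mfin; apply: ainf; apply: card_le_finite mfin.
  apply: card_le_trans (card_le_setX a a am am) _.
  apply: card_le_trans (IH m ma minf) _.
  by apply: subset_card_le => x xm; apply: ord_rel_trans ma.
have small m : ord_rel m a -> ~ (initial_seg a #<= upto m `*` upto m).
  move=> ma am; have [mfin|minf] := pselect (finite_set (initial_seg m)).
    apply: ainf; apply: card_le_finite am _.
    by apply: finite_setX; rewrite finite_setU; split=> //; apply: finite_set1.
  apply: noeq; exists m; split=> //; apply: card_le_trans am _.
  have um := infinite_adjoin m minf.
  by apply: card_le_trans (card_le_setX a a um um) _; apply: IH.
have [|u uP] := @wf_choice (C * C) C (fun p' p => ord_rel (godel p') (godel p))
    (fun p f v => ord_rel p.1 a -> ord_rel p.2 a ->
       ord_rel v a /\ forall p' pp', f p' pp' <> v)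
    (wf_inverse_image _ _ _ godel (@ord_rel_wf _)).
  move=> p f; have [[p1 p2]|] := pselect (ord_rel p.1 a /\ ord_rel p.2 a); last first.
    by move=> no; exists a => p1 p2; case: no.
  apply: contrapT => no; apply: (small _ (pair_max_lt p1 p2)).
  have /choice[h hP] : forall v, exists p', ord_rel v a ->
      exists pp' : ord_rel (godel p') (godel p), f p' pp' = v.
    move=> v; have [va|nva] := pselect (ord_rel v a); last by exists p.
    apply: contrapT => nov; apply: no; exists v => _ _; split=> // p' pp' fv.
    by apply: nov; exists p' => _; exists pp'.
  apply: (@card_le_fun _ _ _ _ h) => [v /hP[/godel_pred //]|v v' va v'a hh].
  have [r fr] := hP v va; have [r' fr'] := hP v' v'a.
  rewrite -{}fr -{}fr'; move: r'; rewrite -hh => r'.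
  by rewrite (Prop_irrelevance r r').
apply: (@card_le_fun _ _ _ _ u) => [p [/= p1 p2]|p p' [/= p1 p2] [/= p1' p2'] uu].
  by have [] := uP p p1 p2.
case: (ord_rel_total (godel p) (godel p')) => [lt|[]//|lt].
  by have [_ /(_ _ lt)] := uP p' p1' p2'.
by have [_ /(_ _ lt)] := uP p p1 p2; case.
Qed.
End Square.

(** [K] is the initial segment of [K + 1] below its last element. *)
Lemma card_ord_sq (K : ord) : infinite_set [set: K] ->
  [set: (K * K)%ord] #<= [set: K].
Proof.
move=> Kinf; have [k0 _] := infinite_setN0 Kinf.
pose S : set (K + 1)%ord := initial_seg (inr tt : (K + 1)%ord).
have KS : [set: K] #<= S.
  by apply: (@card_le_fun _ _ _ _ (inl : K -> (K + 1)%ord)) => // x y _ _ [].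
have SK : S #<= [set: K].
  apply: (@card_le_fun _ _ _ _ (fun x : (K + 1)%ord => if x is inl k then k else k0)) => //.
  by move=> [x|[]] [y|[]] //= _ _ ->.
have Sinf : infinite_set S by move=> Sfin; apply: Kinf; apply: card_le_finite Sfin.
apply: (@card_le_trans _ _ _ (S `*` S)); last first.
  by apply: card_le_trans SK; apply: card_initial_seg_sq.
pose f (p : K * K) : (K + 1)%ord * (K + 1)%ord := (inl p.1, inl p.2).
apply: (@card_le_fun _ _ _ _ f) => //.
by move=> [x y] [x' y'] _ _ [-> ->].
Qed.

(** * Special ordinals over a regular cardinal *)

Section Regular.
Variable K : ord.

(** Says that the cofinality of [A] is at least [K] (or that [A] is empty), a set
of fewer than [K] elements being given as a family indexed by an initial segment of [K]. *)
Definition short_bounded (A : ord) := forall (k : K) (f : K -> A),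
  exists b, forall j, ord_rel j k -> ord_rel (f j) b.

Definition roomy (A : ord) := forall a : A, exists (g : K -> A) (b : A),
  increasing g /\ forall k, ord_rel a (g k) /\ ord_rel (g k) b.

Hypothesis Kreg : infinite_regular_cardinal K.

Lemma regular_no_inj (k : K) (h : K -> K) :
  injective h -> (forall x, ord_rel (h x) k) -> False.
Proof.
case: Kreg => Kc _ _ hinj hk.
apply: (Kc (suborder (initial_seg k))); first by exists k; apply: order_iso_refl.
apply/card_eqPle; split.
  apply: card_le_trans (card_leT (initial_seg k)).
  by have /card_eqPle[] := card_setT (initial_seg k).
pose h' (x : K) : suborder (initial_seg k) := exist _ (h x) (mem_set (hk x)).
have h'inj : {in [set: K] &, injective h'}.
  by move=> x y _ _ /(congr1 val) /hinj.
apply: card_le_trans (card_leT (h' @` setT)).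
by have /card_eqPle[] := inj_card_eq h'inj.
Qed.

(** If the [f j] were cofinal, their set would have order type at least [K]
while being the image of a proper initial segment of [K]. *)
Lemma short_not_cofinal (A : ord) (k : K) (f : K -> A) :
  (forall C : set A, cofinal C -> (K <= suborder C)%ord) ->
  exists b, forall j, ord_rel j k -> ord_rel (f j) b.
Proof.
move=> cofA; apply: contrapT => nob.
have cofC : cofinal (f @` initial_seg k).
  move=> a; apply: contrapT => no; apply: nob; exists a => j jk.
  case: (ord_rel_total (f j) a) => // h; case: no; exists (f j); try by exists j.
    by left.
  by right.
have [h hinj] : exists h : K -> suborder (f @` initial_seg k), injective h.
  case: (cofA _ cofC) => [[b [h /bij_inj hinj _]]|[h /bij_inj hinj _]].
    by exists (val \o h) => x y /val_inj /hinj.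
  by exists h.
have /choice[q qP] : forall x, exists j, ord_rel j k /\ f j = val (h x).
  by move=> x; have [j jk fj] := set_valP (h x); exists j.
apply: (@regular_no_inj k q) => [x y qxy|x]; last by have [] := qP x.
by apply: hinj; apply: val_inj; have [_ <-] := qP x; have [_ <-] := qP y; rewrite qxy.
Qed.

Lemma regular_short_bounded : short_bounded K.
Proof. by move=> k f; apply: short_not_cofinal; case: Kreg => _ _ []. Qed.

Lemma regular_no_max (k : K) : exists k', ord_rel k k'.
Proof.
apply: contrapT => no.
have cof : cofinal [set k].
  move=> a; exists k => //; case: (ord_rel_total a k) => h; [by right|by left|].
  by case: no; exists a.
case: Kreg => _ Kinf [_ /(_ _ cof) le].
have [h hinj] : exists h : K -> suborder [set k], injective h.
  case: le => [[b [h /bij_inj hinj _]]|[h /bij_inj hinj _]].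
    by exists (val \o h) => x y /val_inj /hinj.
  by exists h.
apply: Kinf; apply: (sub_finite_set _ (finite_set1 k)) => x _ /=.
apply: hinj; apply: val_inj.
by have := set_valP (h x); have := set_valP (h k) => /= -> ->.
Qed.

Lemma regular_inhabited : exists k : K, True.
Proof. by case: Kreg => _ /infinite_setN0[k _] _; exists k. Qed.

Lemma regular_zero : exists z : K, forall x, x = z \/ ord_rel z x.
Proof.
have [k _] := regular_inhabited.
have [|z _ zmin] := @ord_min K setT; first by exists k.
exists z => x; case: (ord_rel_total x z) => h; [by case: (zmin x)|by left|by right].
Qed.

(** [m] is the largest argument of the finite support of [f] enlarged by [e1]. *)
Lemma pow_zero_above (E : ord) (z : K) (f : (K ^ E)%ord) (e1 : E) :
  (forall x, x = z \/ ord_rel z x) ->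
  exists m, (m = e1 \/ ord_rel e1 m) /\ forall b, ord_rel m b -> sval f b = z.
Proof.
move=> zP.
have [||m _ mmax] := @finite_ord_max E (pow_supp (sval f) `|` [set e1]).
- by rewrite finite_setU; split; [exact: (svalP f) | exact: finite_set1].
- by exists e1; right.
exists m; split; first by have [|->|] := mmax e1; [right|left|right].
move=> b mb; have [//|zb] := zP (sval f b).
have [|bm|bm] := mmax b; first by left; exists z.
  by subst b; case: (ord_rel_irr mb).
by case: (ord_rel_irr (ord_rel_trans mb bm)).
Qed.

Lemma pow_two_point (E : ord) (z : K) (e0 e : E) (k s : K) :
  (forall x, x = z \/ ord_rel z x) -> e0 <> e ->
  exists f : (K ^ E)%ord, [/\ sval f e0 = k, sval f e = s &
     forall b, b <> e0 -> b <> e -> sval f b = z].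
Proof.
move=> zP e0e.
pose f b := if pselect (b = e0) then k else if pselect (b = e) then s else z.
have fin : finite_set (pow_supp f).
  apply: (sub_finite_set _ (finite_set2 e0 e)) => b [a]; rewrite /f.
  case: pselect => [be0 _|_] /=; first by left.
  case: pselect => [be _|_] /=; first by right.
  by have [->/ord_rel_irr//|za az] := zP a; case: (ord_rel_irr (ord_rel_trans za az)).
exists (exist _ f fin); split=> /=; rewrite /f.
- by case: (pselect (e0 = e0)).
- by case: (pselect (e = e0)) => [/esym//|?]; case: (pselect (e = e)).
- by move=> b b0 be; case: (pselect (b = e0)) => // ?; case: (pselect (b = e)).
Qed.

(** Above a given [a : K ^ E], raise the coefficient at an exponent [m] where
[a] has its last nonzero digit or later, and let the coefficient at a smaller exponent
[e0] run through [K].  The exponent [e0] exists because [E > 1]. *)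
Lemma pow_roomy (E : ord) (e0 e1 : E) : ord_rel e0 e1 -> roomy (K ^ E)%ord.
Proof.
move=> e01 a; have [z zP] := regular_zero.
have [m [me1 mP]] := pow_zero_above a e1 zP.
have e0m : ord_rel e0 m by case: me1 => [->//|]; apply: ord_rel_trans.
have ne : e0 <> m by move=> E0; subst m; case: (ord_rel_irr e0m).
have [s as_] := regular_no_max (sval a m); have [s' ss'] := regular_no_max s.
have /choice[g gP] := fun k => pow_two_point k s zP ne.
have [b [b0 bm bz]] := pow_two_point z s' zP ne.
have gap k c : ord_rel m c -> sval (g k) c = z.
  move=> mc; have [_ _] := gP k; apply=> E0; subst c; last by case: (ord_rel_irr mc).
  by case: (ord_rel_irr (ord_rel_trans e0m mc)).
exists g, b; split=> [k k' kk'|k].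
  exists e0; have [-> gm gz] := gP k; have [-> gm' gz'] := gP k'; split=> // c ec.
  have [->|cm] := pselect (c = m); first by rewrite gm gm'.
  by rewrite gz ?gz' // => E0; subst c; case: (ord_rel_irr ec).
have [g0 gm gz] := gP k.
split; exists m.
  by rewrite gm; split=> // c mc; rewrite mP // gap.
rewrite gm bm; split=> // c mc; rewrite gap // bz // => E0; subst c.
  by case: (ord_rel_irr (ord_rel_trans e0m mc)).
by case: (ord_rel_irr mc).
Qed.

(** If [E] has a last element [e], bound the coefficients at [e], using the
regularity of [K]; if [cf E = K], bound the leading exponents.  In both cases
there are an exponent [e] and a coefficient [s] larger than all coefficients at [e], with
only zeros after [e]. *)
Lemma pow_short_bounded (E : ord) (e0 e1 : E) : ord_rel e0 e1 ->
  is_successor E \/ has_cofinality E K -> short_bounded (K ^ E)%ord.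
Proof.
move=> e01 succof k f; have [z zP] := regular_zero.
have ne : e0 <> e1 by move=> E0; subst e1; case: (ord_rel_irr e01).
suff [e [s [fs fz]]] : exists (e : E) (s : K),
    (forall j, ord_rel j k -> ord_rel (sval (f j) e) s) /\
    (forall j c, ord_rel j k -> ord_rel e c -> sval (f j) c = z).
  have [e' e'e] : exists e', e' <> e.
    have [E0|ne0] := pselect (e0 = e); last by exists e0.
    by exists e1 => E1; apply: ne; rewrite E0 E1.
  have [b [bz' bs bz]] := pow_two_point z s zP e'e.
  exists b => j jk; exists e; rewrite bs; split; first exact: fs.
  move=> c ec; rewrite fz //; have [->//|ce'] := pselect (c = e').
  by rewrite bz // => E0; subst c; case: (ord_rel_irr ec).
case: succof => [[B [h hbij hi]]|cofE].
  have [e ee] : exists e, h e = inr tt by have [g _ gK] := hbij; exists (g (inr tt)).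
  have emax c : ~ ord_rel e c by move/hi; rewrite ee; case: (h c) => [|[]].
  have [s sP] := regular_short_bounded k (fun j => sval (f j) e).
  by exists e, s; split=> // j c _ /emax.
have /choice[m mP] := fun j => pow_zero_above (f j) e1 zP.
have [e eP] := short_not_cofinal k m cofE.2.
have [s zs] := regular_no_max z.
exists e, s; split=> [j jk|j c jk ec].
  by rewrite (mP j).2 //; exact: eP.
by rewrite (mP j).2 //; apply: ord_rel_trans (eP j jk) ec.
Qed.

Lemma short_bounded_iso (A B : ord) :
  order_iso A B -> short_bounded B -> short_bounded A.
Proof.
move=> [h [g hK gK] hi] sB k f; have [b bP] := sB k (h \o f).
by exists (g b) => j jk; apply/hi; rewrite gK; apply: bP.
Qed.

Lemma roomy_iso (A B : ord) : order_iso A B -> roomy B -> roomy A.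
Proof.
move=> [h [g hK gK] hi] rB a; have [f [b [fi fab]]] := rB (h a).
have gi x y : ord_rel x y -> ord_rel (g x) (g y) by move=> xy; apply/hi; rewrite !gK.
exists (g \o f), (g b); split=> [x y xy|k]; first by apply: gi; apply: fi.
by have [af fb] := fab k; split; [apply/hi; rewrite gK|apply: gi].
Qed.

Lemma short_bounded_add (A B : ord) (b0 : B) :
  short_bounded B -> short_bounded (A + B)%ord.
Proof.
move=> sB k f.
have [b bP] := sB k (fun j => if f j is inr y then y else b0).
by exists (inr b) => j /bP; rewrite /=; case: (f j).
Qed.

Lemma roomy_add (A B : ord) (b0 : B) : roomy B -> roomy (A + B)%ord.
Proof.
move=> rB a; have [g [b [gi gb]]] := rB (if a is inr y then y else b0).
exists (fun k => inr (g k)), (inr b); split=> [//|k]; have [ag gb'] := gb k.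
by split=> //; case: a ag {gb} => //.
Qed.

Lemma special_form_short_roomy (A : ord) : special_form K A ->
  [/\ short_bounded A, roomy A & exists a : A, True].
Proof.
move=> [A1 [E [AE [e1 [h [g hg gh] _]] succof]]].
have [e0 e01] : exists e0, ord_rel e0 e1.
  by exists (val (h tt)); apply: (set_valP (h tt)).
have [k _] := regular_inhabited; have [z zP] := regular_zero.
have ne : e0 <> e1 by move=> E0; subst e1; case: (ord_rel_irr e01).
have [b0 _] := pow_two_point k k zP ne.
split.
- apply: (short_bounded_iso AE); apply: (short_bounded_add b0).
  exact: pow_short_bounded e01 succof.
- by apply: (roomy_iso AE); apply: (roomy_add b0); apply: pow_roomy e01.
by have [h' [g' _ _] _] := AE; exists (g' (inr b0)).
Qed.

End Regular.

(** [K * K] is [0 + K ^ 2]: the pair [(k, l)] is the polynomial with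
coefficient [k] in degree 0 and [l] in degree 1. *)
Lemma square_special_form (K : ord) (z : K) : special_form K (K * K)%ord.
Proof.
pose Z := suborder (set0 : set K).
have fin (f : (1 + 1)%ord -> K) : finite_set (pow_supp f).
  exact: (@finite_finset (unit + unit)%type).
exists Z, (1 + 1)%ord; split.
- pose f (p : (K * K)%ord) : (Z + K ^ (1 + 1))%ord :=
    inr (exist _ (fun b : (1 + 1)%ord => if b is inl _ then p.1 else p.2) (fin _)).
  apply: (@increasing_surj_iso _ _ f) => [[k l] [k' l'] [/= lt|[/= -> lt]]|[[y]|[y yf]]].
  + by exists (inr tt) => /=; split=> // -[[]|[]].
  + by exists (inl tt) => /=; split=> // -[[]|[]].
  + by move=> y0; have := set_mem y0.
  exists (y (inl tt), y (inr tt)); congr inr; apply: eq_exist.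
  by apply: functional_extensionality_dep => -[[]|[]].
- exists (inr tt).
  have in1 : (initial_seg (inr tt : (1 + 1)%ord)) (inl tt) by [].
  pose f (x : ord_one) : suborder (initial_seg (inr tt : (1 + 1)%ord)) :=
    exist _ (inl tt) (mem_set in1).
  apply: (@increasing_surj_iso _ _ f) => [x y []|y].
  have := set_valP y; case E: (val y) => [[]|[]]; last by case.
  by exists tt; apply: val_inj.
by left; exists 1%ord; apply: order_iso_refl.
Qed.

(** * Independent points and grids *)

Section Room.
Variables K A : ord.
Hypothesis (Kreg : infinite_regular_cardinal K) (rA : roomy K A).

(** Stack [n] bounded copies of [K].  The map [g] is defined on all of [K * omega] but only
its first [n] blocks matter; for [A = K ^ 2] no copy of [K * omega] is
bounded, which is why [n] is fixed first. *)
Lemma roomy_mul (n : nat) (a : A) : exists (g : (K * ord_omega)%ord -> A) (b : A),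
  [/\ ord_rel a b,
      forall p : (K * ord_omega)%ord, p.2 < n -> ord_rel a (g p) /\ ord_rel (g p) b &
      forall p p' : (K * ord_omega)%ord, ord_rel p p' -> p'.2 < n -> ord_rel (g p) (g p')].
Proof.
have [k0 _] := regular_inhabited Kreg.
elim: n => [|n [g [b [ab gb gi]]]].
  have [g [b [_ gb]]] := rA a; exists (fun=> a), b; split=> //.
  by have [ag gkb] := gb k0; apply: ord_rel_trans gkb.
have [g' [b' [gi' gb']]] := rA b.
have bb' : ord_rel b b' by have [bg gkb] := gb' k0; apply: ord_rel_trans gkb.
exists (fun p => if p.2 < n then g p else g' p.1), b'; split.
- exact: ord_rel_trans bb'.
- move=> p pn; case: ifP => [/gb[ag gpb]|_].
    by split=> //; apply: ord_rel_trans bb'.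
  by have [bg gkb] := gb' p.1; split=> //; apply: ord_rel_trans bg.
- move=> p p' pp' p'n; case: (ltnP p'.2 n) => [lt'|ge'].
    have -> : p.2 < n.
      by case: pp' => [/= lt|[-> //]]; apply: ltn_trans lt'.
    exact: gi.
  case: (ltnP p.2 n) => [lt|ge].
    by have [_ gpb] := gb p lt; have [bg _] := gb' p'.1; apply: ord_rel_trans bg.
  case: pp' => [/= lt|[_]]; last exact: gi'.
  by rewrite ltnS in p'n; move: (leq_trans lt p'n); rewrite ltnNge ge.
Qed.
End Room.

Section Grid.
Variables (K A A' : ord) (X : Type) (s : K -> X) (O : A' -> set X).
Variable phi : A' -> (A + K * ord_omega)%ord.
Variable top : (A + K * ord_omega)%ord.
Hypothesis Kreg : infinite_regular_cardinal K.
Hypothesis sA : short_bounded K A.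
Hypothesis rA : roomy K A.
Variable a0 : A.
Hypothesis s_surj : forall x, exists k, s k = x.
Hypothesis phi_inc : increasing phi.
Hypothesis phi_top : forall d, ord_rel (phi d) top.
Hypothesis O_cover : forall x, exists d, O d x.
Hypothesis O_large : forall H : set A', (suborder H < A)%ord ->
  exists x, forall d, H d -> ~ O d x.

(** The indices of the sets containing [x] are, through [phi], elements of [A]
below [c]. *)
Definition below (c : A) (x : X) :=
  forall d, O d x -> exists2 a, phi d = inl a & ord_rel a c.

(** The indices that are outside [A], or below [c], or in a thin cover [u] of
the unbounded points form a set [H] of type less than [A].  So [H] misses a
point; it is bounded since [u] misses it, and its indices lie in [A] above [c]
since the rest of [H] misses it. *)
Lemma far_point (c : A) : exists x,
  (exists c', below c' x) /\
  forall d, O d x -> exists2 a, phi d = inl a & ~ ord_rel a c.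
Proof.
pose unb k := ~ exists c', below c' (s k).
have [|u uP] := @wf_choice K A' (@ord_rel K) (fun k f v => unb k ->
    O v (s k) /\ forall j (jk : ord_rel j k) a b,
      phi (f j jk) = inl a -> phi v = inl b -> ord_rel a b) (@ord_rel_wf K).
  move=> k f; have [v0 _] := O_cover (s k).
  have [unbk|] := pselect (unb k); last by exists v0.
  (* [c] is only a default for the indices outside [A]. *)
  pose F j := if pselect (ord_rel j k) is left jk then
    (if phi (f j jk) is inl a then a else c) else c.
  have [b bP] := sA k F.
  have [v [Ov vP]] : exists v, O v (s k) /\
      ~ exists2 a, phi v = inl a & ord_rel a b.
    apply: contrapT => no; apply: unbk; exists b => d Od; apply: contrapT => nd.
    by apply: no; exists d.
  exists v => _; split=> // j jk a a' fa va'.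
  have := bP j jk; rewrite /F; case: pselect => [jk'|//].
  rewrite (Prop_irrelevance jk' jk) fa => ab.
  case: (ord_rel_total a a') => // [E|a'a]; case: vP; exists a' => //.
    by rewrite -E.
  exact: ord_rel_trans ab.
have [k0 _] := regular_inhabited Kreg.
(* [ix] recovers the stage at which an index of the thin cover was chosen. *)
have /choice[ix ixP] : forall d, exists k,
    (exists2 k, unb k & u k = d) -> unb k /\ u k = d.
  by move=> d; have [[k uk ukd]|no] := pselect (exists2 k, unb k & u k = d);
    [exists k|exists k0].
have [n nP] : exists n : nat, forall d (p : (K * ord_omega)%ord), phi d = inr p -> p.2 < n.
  case: top phi_top => [a|[k n]] topP.
    by exists 0 => d p dp; have := topP d; rewrite dp.
  exists n.+1 => d p dp; have := topP d; rewrite dp ltnS.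
  by case=> [/= /ltnW//|[/= -> //]].
have [g1 [b1 [g1i g1b]]] := rA c.
have [g2 [b2 [b12 g2b g2i]]] := roomy_mul Kreg rA n b1.
have cb1 : ord_rel c b1 by have [cg gb] := g1b k0; apply: ord_rel_trans gb.
(* [H] is squeezed into [A]: the part below [c] stays in place, the thin cover
   follows as a copy of [K] below [b1], and the indices outside [A] come last, as
   a part of a copy of [K * n] below [b2]. *)
pose H d := [\/ exists p, phi d = inr p, exists2 a, phi d = inl a & ord_rel a c
  | exists2 k, unb k & u k = d].
pose f d := match phi d with
  | inl a => if pselect (ord_rel a c) then a else g1 (ix d)
  | inr p => g2 p end.
have fb1 d a : phi d = inl a -> ord_rel (f d) b1.
  rewrite /f => ->; case: pselect => [ac|?] /=; first exact: ord_rel_trans cb1.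
  by have [] := g1b (ix d).
have [x xP] : exists x, forall d, H d -> ~ O d x.
  apply: O_large; apply: (@bounded_suborder_lt _ _ _ f b2).
    move=> d d' Hd Hd' /phi_inc; case E: (phi d) => [a|p]; case E': (phi d') => [a'|p'] //=.
    - move=> aa'; rewrite /f E E'.
      case: (pselect (ord_rel a' c)) => [a'c|na'c].
        by case: pselect => // nac; case: nac; apply: ord_rel_trans a'c.
      case: (pselect (ord_rel a c)) => [ac|nac].
        by have [cg _] := g1b (ix d'); apply: ord_rel_trans cg.
      have inU e b : phi e = inl b -> H e -> ~ ord_rel b c -> unb (ix e) /\ u (ix e) = e.
        move=> eb He nbc; apply: ixP; case: He => // [[p]|[b']]; rewrite eb //.
        by case=> <-.
      have [ud ude] := inU _ _ E Hd nac; have [ud' ude'] := inU _ _ E' Hd' na'c.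
      apply: g1i; case: (ord_rel_total (ix d) (ix d')) => // [Ei|lt].
        have dd' : d = d' by rewrite -ude Ei.
        by move: E'; rewrite -dd' E => -[aa]; subst a'; case: (ord_rel_irr aa').
      have [_ /(_ _ lt a' a)] := uP _ ud; rewrite ude ude' => /(_ E' E) a'a.
      by case: (ord_rel_irr (ord_rel_trans aa' a'a)).
    - move=> _; apply: (ord_rel_trans (fb1 d a E)); rewrite /f E'.
      by have [] := g2b p' (nP _ _ E').
    - by move=> pp'; rewrite /f E E'; apply: g2i => //; apply: nP E'.
  move=> d _; case E: (phi d) => [a|p]; first exact: ord_rel_trans (fb1 d a E) b12.
  by rewrite /f E; have [] := g2b p (nP _ _ E).
exists x; have [k kx] := s_surj x.
have [c' c'P] : exists c', below c' x.
  apply: contrapT => nb; have unbk : unb k by rewrite /unb kx.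
  have [Ou _] := uP k unbk; apply: (xP (u k)); last by rewrite -kx.
  by apply: Or33; exists k.
split; first by exists c'.
move=> d Od; have [a da ac'] := c'P d Od; exists a => // ac.
by apply: (xP d) => //; apply: Or32; exists a.
Qed.

(** A pair [(c, t)] with [c < t] stands for the [t]-th point of class [c].  The
recursion along [K * K] treats, at stage [t], all classes [c < t] in turn; it
thus makes room for [K] points in each of [K] classes, while fewer than [K]
points precede any given one. *)
Lemma independent_points (q : K -> A') : exists y : (K * K)%ord -> X,
  forall p : (K * K)%ord, ord_rel p.1 p.2 ->
  (forall p' : (K * K)%ord, ord_rel p' p -> ord_rel p'.1 p'.2 ->
     forall d, O d (y p) -> ~ O d (y p')) /\
  (forall k, ord_rel k p.2 -> ~ O (q k) (y p)).
Proof.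
have /choice[bd bdP] : forall x, exists c0, (exists c, below c x) -> below c0 x.
  by move=> x; have [[c bc]|no] := pselect (exists c, below c x); [exists c|exists a0].
have [|y yP] := @wf_choice (K * K)%ord X (@ord_rel _) (fun p f x => ord_rel p.1 p.2 ->
    [/\ exists c, below c x,
        forall (p' : (K * K)%ord) (pp' : ord_rel p' p), ord_rel p'.1 p'.2 ->
          (exists c, below c (f p' pp')) -> forall d, O d x -> ~ O d (f p' pp') &
        forall k, ord_rel k p.2 -> ~ O (q k) x]) (@ord_rel_wf (K * K)%ord).
  move=> p f.
  pose beta c t := if pselect (ord_rel ((c, t) : (K * K)%ord) p) is left ctp
    then bd (f (c, t) ctp) else a0.
  (* Regularity is used twice: over the classes at each stage, then over the stages. *)
  have /choice[B BP] := fun t => sA t (beta^~ t).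
  have [t' tt'] := regular_no_max Kreg p.2.
  have [b1 b1P] := sA t' B.
  have [b2 b2P] := sA p.2 (fun k => if phi (q k) is inl a then a else a0).
  have [b [bb1 bb2]] := ord_max2 b1 b2.
  have [x [xbd xfar]] := far_point b.
  exists x => _; split=> // [[c t] pp' ct fbd d Od Ofd|k kp Oq].
    have [a da nab] := xfar d Od; apply: nab.
    have [a' + aa'] := bdP _ fbd _ Ofd; rewrite da => -[?]; subst a'.
    apply: bb1; apply: (@ord_rel_trans _ (B t)).
      apply: ord_rel_trans aa' _; have := BP t c ct; rewrite /beta.
      by case: pselect => [pp''|//]; rewrite (Prop_irrelevance pp'' pp').
    apply: b1P; have [/= lt|[/= -> //]] := pp'; exact: ord_rel_trans tt'.
  have [a qa nab] := xfar _ Oq; apply: nab; apply: bb2.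
  by have := b2P k kp; rewrite qa.
exists y => p pv; have [_ ypp yk] := yP p pv; split=> // p' pp' pv'.
by apply: ypp => //; have [] := yP p' pv'.
Qed.

(** With [q k] an index of a set containing [s k], position [k] of column [c] is
[q k], unless [q k] is the index of a set containing a witness of another column; it is
then filled with [q (k0 c)], which belongs to column [c] itself. *)
Lemma independent_grid (I : Type) (i0 : I) (j : I -> K) : injective j ->
  exists N : K -> I -> A',
  [/\ forall x, exists k c, O (N k c) x &
      forall c k, exists x, (forall k' c', c' <> c -> ~ O (N k' c') x) /\
        forall k', ord_rel k' k -> ~ O (N k' c) x].
Proof.
move=> jinj; have /choice[q qP] := fun k => O_cover (s k).
have [y yP] := independent_points q.
(* [D c]: the indices of the sets that contain a witness of column [c]. *)
pose D c d := exists2 t, ord_rel (j c) t & O d (y (j c, t)).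
have Ddisj c c' d : D c d -> D c' d -> c = c'.
  move=> [t ct Od] [t' ct' Od'].
  case: (ord_rel_total ((j c, t) : (K * K)%ord) (j c', t')) => [lt|[/jinj//]|lt].
    by have [/(_ _ lt ct _ Od')] := yP (j c', t') ct'.
  by have [/(_ _ lt ct' _ Od)] := yP (j c, t) ct.
have /choice[k0 k0P] : forall c, exists k, D c (q k).
  move=> c; have [t ct] := regular_no_max Kreg (j c).
  by have [k ky] := s_surj (y (j c, t)); exists k, t; rewrite // -ky.
pose other c k := exists2 c', c' <> c & D c' (q k).
pose w k c := if pselect (other c k) then k0 c else k.
exists (fun k c => q (w k c)); split=> [x|c k].
  have [k kx] := s_surj x; exists k.
  have [[c Dc]|no] := pselect (exists c, D c (q k)); [exists c|exists i0]; rewrite /w -kx.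
    by case: pselect => [[c' cc' Dc']|no'] /=; [case: cc'; apply: Ddisj Dc' Dc|].
  by case: pselect => [[c' cc' Dc']|no'] /=; [case: no; exists c'|].
have [t1 k0t1] := regular_no_max Kreg (k0 c).
have [t2 kt2] := regular_no_max Kreg (j c).
have [t3 [t31 t32]] := ord_max2 t1 t2; have [t [tt3 tk]] := ord_max2 t3 k.
have ct : ord_rel (j c) t by apply: tt3; apply: t32.
have k0t : ord_rel (k0 c) t by apply: tt3; apply: t31.
exists (y (j c, t)); split=> [k' c' c'c|k' k'k]; rewrite /w; case: pselect => [o|no] /= Oy.
- by apply: c'c; apply: Ddisj (k0P c') _; exists t.
- by apply: no; exists c; [move=> E; apply: c'c|exists t].
- by have [_ /(_ _ k0t)] := yP (j c, t) ct.
- by have [_ /(_ _ (tk _ k'k))] := yP (j c, t) ct.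
Qed.
End Grid.

(** * Grids and compactness *)

Section Grids.
Variables (K : ord) (X : Type) (tau : set (set X)).
Hypothesis Kreg : infinite_regular_cardinal K.
Hypothesis cardX : [set: X] #= [set: K].

(** The last clause provides the witnesses of column [c]. *)
Definition grid (J : Type) (N : K -> J -> set X) :=
  [/\ forall k c, tau (N k c), forall x, exists k c, N k c x &
    forall c k, exists x, (forall k' c', c' <> c -> ~ N k' c' x) /\
        forall k', ord_rel k' k -> ~ N k' c x].

Lemma noncompact_grid (A A' : ord) (J : Type) (i0 : J) (j : J -> K) :
  special_form K A -> (A' < A + K * ord_omega)%ord -> ~ ord_compact tau A A' ->
  injective j -> exists N : K -> J -> set X, grid N.
Proof.
move=> sf [top [h _ hi]] nc jinj.
have [sA rA [a0 _]] := special_form_short_roomy Kreg sf.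
have [O [Otau Ocov Olarge]] : exists O : A' -> set X, [/\ forall d, tau (O d),
    forall x, exists d, O d x &
    forall H : set A', (suborder H < A)%ord -> exists x, forall d, H d -> ~ O d x].
  apply: contrapT => no; apply: nc => O Otau Ocov; apply: contrapT => noH.
  apply: no; exists O; split=> // [x|H HA].
    have : [set: X] x by [].
    by rewrite -Ocov => -[d _ Od]; exists d.
  apply: contrapT => nox; apply: noH; exists H => //; apply/seteqP; split=> // x _.
  apply: contrapT => nd; apply: nox; exists x => d Hd Od; apply: nd; by exists d.
have [k0 _] := regular_inhabited Kreg.
have [s s_surj] : exists s : K -> X, forall x, exists k, s k = x.
  have /card_eqPle[/(card_le_ex k0)[r [_ rI]] _] := cardX.
  have /choice[s sP] : forall k, exists x, (exists x', r x' = k) -> r x = k.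
    move=> k; have [[x rx]|no] := pselect (exists x, r x = k); first by exists x.
    have [x0 _] : exists x0 : X, True.
      apply: contrapT => nox.
      have /card_eqPle[_ /card_leP[f]] := cardX.
      by apply: nox; exists (val (f (exist _ k0 (mem_set I)))).
    by exists x0 => /no.
  exists s => x; exists (r x); apply: rI => //; by apply: sP; exists x.
have [|d|N [Ncov Nind]] := @independent_grid K A A' X s O (fun d => val (h d)) top
   Kreg sA rA a0 s_surj _ _ Ocov Olarge J i0 j jinj.
- by move=> d d' /hi.
- exact: (set_valP (h d)).
by exists (fun k c => O (N k c)); split.
Qed.

(** By regularity, an unbounded subset of [K] has order type [K]. *)
Lemma unbounded_increasing (S : set K) : (forall k, exists2 l, S l & ~ ord_rel l k) ->
  exists e : K -> K, increasing e /\ forall k, S (e k).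
Proof.
move=> Sunb.
have [|e eP] := @wf_choice K K (@ord_rel K) (fun k f v => S v /\
   forall j (jk : ord_rel j k), ord_rel (f j jk) v) (@ord_rel_wf K).
  move=> k f; have [b bP] := regular_short_bounded Kreg k
    (fun j => if pselect (ord_rel j k) is left jk then f j jk else k).
  have [l Sl lb] := Sunb b; exists l; split=> // j jk.
  have := bP j jk; case: pselect => [jk'|//]; rewrite (Prop_irrelevance jk' jk) => fb.
  by case: (ord_rel_total l b) => // [->//|]; apply: ord_rel_trans.
by exists e; split=> [j k jk|k]; have [? ?] := eP k => //; auto.
Qed.

(** In any subcover [H], the witnesses of a column make the part of [H] in that
column unbounded, so that it contains a copy of [K]; together these copies form
a copy of [K * A1] in [H]. *)
Lemma grid_not_compact_mul (A A1 : ord) (N : K -> A1 -> set X) :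
  grid N -> order_iso A (K * A1)%ord -> ~ ord_compact tau A A.
Proof.
move=> [Ntau Ncov Nind] [h [g hK gK] hi] comp.
have [||H] := comp (fun d => N (h d).1 (h d).2); first by move=> d; apply: Ntau.
  apply/seteqP; split=> // x _; have [k [c Nx]] := Ncov x.
  by exists (g (k, c)) => //; rewrite gK.
move=> HA Hcov.
have /choice[e eP] : forall c, exists e : K -> K, increasing e /\ forall k, H (g (e k, c)).
  move=> c; apply: (@unbounded_increasing [set l | H (g (l, c))]) => k.
  have [x [xo xk]] := Nind c k.
  have : [set: X] x by [].
  rewrite -Hcov => -[d Hd]; case E: (h d) => [l c'] /= Nx.
  have cc' : c' = c by apply: contrapT => ne; apply: xo ne Nx.
  subst c'; exists l => /=; first by rewrite -E hK.
  by move=> lk; apply: xk lk Nx.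
apply: (@suborder_not_lt A A H (fun d => g (e (h d).2 (h d).1, (h d).2))) HA => [x y|d].
  move=> /hi xy; apply/hi; rewrite !gK.
  case: xy => [lt|[E lt]]; [by left|right]; split=> //=; rewrite E.
  by apply: (eP _).1.
exact: (eP _).2.
Qed.

(** The witnesses of a column are covered by no other column. *)
Lemma grid_not_compact_union (A : ord) (N : K -> A -> set X) :
  union_closed tau -> grid N -> ~ ord_compact tau A A.
Proof.
move=> tauU [Ntau Ncov Nind] comp.
have [||H] := comp (fun c => \bigcup_(U in range (N^~ c)) U).
- by move=> c; apply: tauU => _ [k _ <-].
- apply/seteqP; split=> // x _; have [k [c Nx]] := Ncov x.
  by exists c => //; exists (N k c) => //; exists k.
move=> HA Hcov; have [k0 _] := regular_inhabited Kreg.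
apply: (@suborder_not_lt A A H id) HA => // c.
have [x [xo _]] := Nind c k0.
have : [set: X] x by [].
rewrite -Hcov => -[c' Hc' [_ [k _ <-] Nx]].
by have [<-//|ne] := pselect (c' = c); case: (xo k c' ne Nx).
Qed.

End Grids.

Theorem theorem4p5 (K : ord) (X : Type) (tau : set (set X)) :
  infinite_regular_cardinal K ->
  [set: X] #= [set: K] ->
  tau !=set0 ->
  let P1 := ord_compact tau (K * K) (K * K) in
  let P2 := exists A : ord,
    [/\ is_limit A,
        exists A1 : ord,
          [/\ order_iso A (K * A1)%ord, ord_nonzero A1 & [set: A1] #<= [set: K]] &
        ord_compact tau A A] in
  let P3 := forall A : ord, special_form K A -> ord_compact tau A A in
  let P4 := forall A : ord, special_form K A ->
    ord_compact_below tau A (A + K * ord_omega) in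
  let P5 := exists A : ord,
    [/\ ord_nonzero A, [set: A] #<= [set: K] & ord_compact tau A A] in
  [<-> P1; P2; P3; P4] /\ (union_closed tau -> (P1 <-> P5)).
Proof.
move=> Kreg cardX _ P1 P2 P3 P4 P5.
have [k0 _] := regular_inhabited Kreg.
have o0 : (K * ord_omega)%ord := (k0, 0).
have kk : special_form K (K * K)%ord by apply: square_special_form.
have P12 : P1 -> P2.
  move=> p1; exists (K * K)%ord; split=> //; last first.
    by exists K; split; [apply: order_iso_refl|exists k0|apply: card_lexx].
  split; first by exists (k0, k0).
  move=> [B [h [g hK gK] hi]]; case E: (g (inr tt)) => [k l].
  have [k' kk'] := regular_no_max Kreg k.
  have : ord_rel ((k, l) : (K * K)%ord) (k', l) by right.
  by move/hi; rewrite -E gK; case: (h _) => [|[]].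
have P24 : P2 -> P4.
  move=> [B [_ [A1 [BA1 [c0 _] A1K] compB]]] A sf A' _ A'A.
  apply: contrapT => nc.
  have [j [_ jI]] := card_le_ex k0 A1K.
  have [N gN] := noncompact_grid Kreg cardX c0 sf A'A nc (fun x y => jI x y I I).
  exact: (grid_not_compact_mul Kreg gN BA1 compB).
have P43 : P4 -> P3.
  move=> p4 A sf; have [_ _ [a0 _]] := special_form_short_roomy Kreg sf.
  by apply: p4 => //; [exists a0|apply: lt_add o0].
have P31 : P3 -> P1 by move=> p3; apply: p3.
split; first by tfae=> //; auto.
move=> tauU; split=> [p1|[A [[c0 _] AK comp]]].
  exists (K * K)%ord; split=> //; first by exists (k0, k0).
  by apply: card_ord_sq; case: Kreg.
apply: contrapT => np1.
have [j [_ jI]] := card_le_ex k0 AK.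
have [N gN] := noncompact_grid Kreg cardX c0 kk (lt_add _ o0) np1 (fun x y => jI x y I I).
exact: (grid_not_compact_union Kreg tauU gN comp).
Qed.
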